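(* Let $G$ be a finite-dimensional Lie group with Lie algebra $\mathfrak{g}$ acting on the left on a manifold $M$, let $a_{\rm ref}\in M$, and let $\ell:\mathfrak{g}\times\operatorname{Orb}(a_{\rm ref})\times\mathbb{R}\to\mathbb{R}$, $f^{\rm ext},f^{\rm fr}:\mathfrak{g}\times\operatorname{Orb}(a_{\rm ref})\times\mathbb{R}\to\mathfrak{g}^*$, $p_H^{\rm ext}:\mathfrak{g}\times\operatorname{Orb}(a_{\rm ref})\times\mathbb{R}\to\mathbb{R}$ be the reduced maps associated with a $G_{a_{\rm ref}}$-invariant Lagrangian $L_{a_{\rm ref}}:TG\times\mathbb{R}\to\mathbb{R}$, fiber-preserving $G_{a_{\rm ref}}$-equivariant external and friction forces $F^{\rm ext}_{a_{\rm ref}},F^{\rm fr}_{a_{\rm ref}}:TG\times\mathbb{R}\to T^*G$, and a $G_{a_{\rm ref}}$-invariant external heat power $P^{\rm ext}_{H,a_{\rm ref}}:TG\times\mathbb{R}\to\mathbb{R}$. Suppose that $(g,\xi,a,S)$ is a curve with $g(t)\in G$, $\xi=g^{-1}\dot g$, $a=g^{-1}a_{\rm ref}$, $S(t)\in\mathbb{R}$, satisfying $$\frac{d}{dt}\frac{\partial\ell}{\partial\xi}(\xi,a,S)=\operatorname{ad}^*_\xi\frac{\partial\ell}{\partial\xi}(\xi,a,S)-\mathbf{J}\Big(\frac{\partial\ell}{\partial a}(\xi,a,S)\Big)+f^{\rm ext}(\xi,a,S)+f^{\rm fr}(\xi,a,S),$$ $$\frac{\partial\ell}{\partial S}(\xi,a,S)\,\dot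 S=\langle f^{\rm fr}(\xi,a,S),\xi\rangle-p^{\rm ext}_H(\xi,a,S),\qquad \dot a+\xi_M(a)=0.$$ Let $e:\mathfrak{g}\times\operatorname{Orb}(a_{\rm ref})\times\mathbb{R}\to\mathbb{R}$ be the reduced energy $$e(\xi,a,S)=\Big\langle\frac{\partial\ell}{\partial\xi}(\xi,a,S),\xi\Big\rangle-\ell(\xi,a,S),$$ and let $p^{\rm ext}_W:\mathfrak{g}\times\operatorname{Orb}(a_{\rm ref})\times\mathbb{R}\to\mathbb{R}$ be the reduced power of the external forces, $p^{\rm ext}_W(\xi,a,S)=\langle f^{\rm ext}(\xi,a,S),\xi\rangle$. Then along the curve $(g,\xi,a,S)$ $$\frac{de}{dt}=p^{\rm ext}_W(\xi,a,S)+p^{\rm ext}_H(\xi,a,S).$$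
   Context: All maps and curves are smooth. $G_{a_{\rm ref}}\subset G$ is the isotropy subgroup of $a_{\rm ref}$ and $\operatorname{Orb}(a_{\rm ref})\subset M$ its $G$-orbit; actions are written by concatenation. For $\xi\in\mathfrak{g}$, $\xi_M(x)=\frac{d}{ds}\big|_{s=0}\exp(s\xi)x$ is the infinitesimal generator on $M$. For $(g,\dot g)\in TG$, $g^{-1}\dot g:=T_gL_{g^{-1}}\dot g\in\mathfrak{g}$. A map $F:TG\times\mathbb{R}\to T^*G$ is fiber-preserving if $F(g,\dot g,S)\in T_g^*G$. A map $\Phi:TG\times\mathbb{R}\to\mathbb{R}$ is $G_{a_{\rm ref}}$-invariant if $\Phi(gh,g\dot h,S)=\Phi(h,\dot h,S)$ for all $g\in G_{a_{\rm ref}}$, $(h,\dot h)\in TG$, $S\in\mathbb{R}$; its reduced map is defined by $\varphi(g^{-1}\dot g,g^{-1}a_{\rm ref},S)=\Phi(g,\dot g,S)$. A fiber-preserving map $\Phi:TG\times\mathbb{R}\to T^*G$ is $G_{a_{\rm ref}}$-equivariant if $\Phi(gh,g\dot h,S)=g\,\Phi(h,\dot h,S)$ for all $g\in G_{a_{\rm ref}}$ (cotangent-lifted left translation); its reduced map is $\varphi(g^{-1}\dot g,g^{-1}a_{\rm ref},S)=g^{-1}\Phi(g,\dot g,S)\in\mathfrak{g}^*$, where $\langle g^{-1}\alpha_g,\eta\rangle=\langle\alpha_g,T_eL_g\eta\rangle$. $\operatorname{ad}^*_\xi$ is given by $\langle\operatorname{ad}^*_\xi\mu,\eta\rangle=\langle\mu,[\xi,\eta]\rangle$.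 $\mathbf{J}:T^*M\to\mathfrak{g}^*$ is the momentum map $\langle\mathbf{J}(\alpha_x),\xi\rangle=\langle\alpha_x,\xi_M(x)\rangle$; the same formula defines $\mathbf{J}(\partial\ell/\partial a)$ since $\xi_M(a)$ is tangent to $\operatorname{Orb}(a_{\rm ref})$. *)

(* Defs.v *)
(* Library: MathComp-Analysis, over an arbitrary R : realType.

   Finite-dimensional smooth manifolds are given by a family of charts on a
   bare type, the topology being the one determined by the charts.  As is usual
   in formal libraries, each point x has a preferred chart [chart_at x], and the
   tangent space T_xM is the model space 'rV_n, a vector being represented by
   its coordinates in that chart.  Accordingly the cotangent space T*_xM is
   'cV_n, with <mu, v> the entry of v *m mu.  TM and T*M have carriers
   M * 'rV_n and M * 'cV_n, and their charts [tangent_atlas], [cotangent_atlas]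
   contain the usual transition functions (so their manifold structure is not
   that of a product).  The Lie algebra of a Lie group G is T_1G. *)

From HB Require Import structures.
From mathcomp Require Import all_boot all_order all_algebra.
From mathcomp Require Import all_classical all_reals all_analysis.

Set Implicit Arguments.
Unset Strict Implicit.
Unset Printing Implicit Defensive.

Import Order.TTheory GRing.Theory Num.Theory.
Import numFieldNormedType.Exports.

Local Open Scope classical_set_scope.
Local Open Scope ring_scope.

(* On finite-dimensional spaces, and for U open, this is the usual C^k: all
   iterated directional derivatives up to order k exist and are continuous. *)
Fixpoint Ck (R : realType) (V W : normedModType R) (k : nat)
    (U : set V) (f : V -> W) : Prop :=
  if k is k'.+1 then
    (forall x, U x -> differentiable f x) /\
    (forall v : V, Ck k' U (fun x => 'D_v f x))
  else forall x, U x -> {for x, continuous f}.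

Definition Cinfty (R : realType) (V W : normedModType R)
    (U : set V) (f : V -> W) : Prop :=
  open U /\ forall k, Ck k U f.

(* [param c] is the inverse of the chart [coord c]; it is only meaningful on
   the image of [dom c]. *)
Record atlas (R : realType) (V : normedModType R) (M : Type) := Atlas {
  chart : Type;
  chart_at : M -> chart;
  dom : chart -> set M;
  coord : chart -> M -> V;
  param : chart -> V -> M }.

Definition mopen (R : realType) (V : normedModType R) (M : Type)
    (A : atlas V M) (U : set M) : Prop :=
  forall c : chart A, open (coord c @` (U `&` dom c)).

Definition is_manifold (R : realType) (V : normedModType R) (M : Type)
    (A : atlas V M) : Prop :=
  [/\ forall x : M, dom (chart_at A x) x,
      forall (c : chart A) (x : M), dom c x -> param c (coord c x) = x,
      forall c d : chart A,
        Cinfty (coord c @` (dom c `&` dom d)) (coord d \o param c),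
      (forall x y : M, x <> y -> exists U W : set M,
        [/\ mopen A U, mopen A W, U x, W y & U `&` W = set0]) &
      exists B : nat -> set M, (forall i, mopen A (B i)) /\
        forall (U : set M) (x : M), mopen A U -> U x ->
          exists2 i, B i x & B i `<=` U].

Definition smooth_on (R : realType) (V W : normedModType R) (M N : Type)
    (AM : atlas V M) (AN : atlas W N) (D : set M) (f : M -> N) : Prop :=
  (forall U, mopen AN U -> mopen AM (D `&` f @^-1` U)) /\
  (forall (c : chart AM) (d : chart AN),
     Cinfty (coord c @` (D `&` dom c `&` f @^-1` dom d))
            (coord d \o f \o param c)).

Definition smooth (R : realType) (V W : normedModType R) (M N : Type)
    (AM : atlas V M) (AN : atlas W N) (f : M -> N) : Prop :=
  smooth_on AM AN setT f.

Definition vect_atlas (R : realType) (V : normedModType R) : atlas V V :=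
  @Atlas R V V unit (fun=> tt) (fun=> setT) (fun=> id) (fun=> id).

Definition prod_atlas (R : realType) (V W : normedModType R) (M N : Type)
    (AM : atlas V M) (AN : atlas W N) : atlas (V * W)%type (M * N)%type :=
  @Atlas R (V * W)%type (M * N)%type (chart AM * chart AN)%type
    (fun x => (chart_at AM x.1, chart_at AN x.2))
    (fun c => dom c.1 `*` dom c.2)
    (fun c x => (coord c.1 x.1, coord c.2 x.2))
    (fun c u => (param c.1 u.1, param c.2 u.2)).

Definition line (R : realType) : atlas R^o R := vect_atlas R^o.

(* Linear maps act on row vectors from the right: a tangent vector v is mapped
   to v *m T and a covector mu is pulled back to T *m mu. *)

Definition pairing (R : realType) (n : nat) (mu : 'cV[R]_n) (v : 'rV[R]_n) : R :=
  (v *m mu) 0 0.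

Definition chart_change (R : realType) (n : nat) (M : Type)
    (A : atlas 'rV[R]_n M) (c d : chart A) (x : M) : 'M[R]_n :=
  jacobian (coord d \o param c) (coord c x).

Definition tangent_atlas (R : realType) (n : nat) (M : Type)
    (A : atlas 'rV[R]_n M) :
    atlas ('rV[R]_n * 'rV[R]_n)%type (M * 'rV[R]_n)%type :=
  @Atlas R ('rV[R]_n * 'rV[R]_n)%type (M * 'rV[R]_n)%type (chart A)
    (fun p => chart_at A p.1)
    (fun c p => dom c p.1)
    (fun c p => (coord c p.1, p.2 *m chart_change (chart_at A p.1) c p.1))
    (fun c u => let x := param c u.1 in
                (x, u.2 *m chart_change c (chart_at A x) x)).

Definition cotangent_atlas (R : realType) (n : nat) (M : Type)
    (A : atlas 'rV[R]_n M) :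
    atlas ('rV[R]_n * 'cV[R]_n)%type (M * 'cV[R]_n)%type :=
  @Atlas R ('rV[R]_n * 'cV[R]_n)%type (M * 'cV[R]_n)%type (chart A)
    (fun p => chart_at A p.1)
    (fun c p => dom c p.1)
    (fun c p => (coord c p.1, chart_change c (chart_at A p.1) p.1 *m p.2))
    (fun c u => let x := param c u.1 in
                (x, chart_change (chart_at A x) c x *m u.2)).

(* T_x f : T_xM -> T_{f x}N *)
Definition tmap (R : realType) (m n : nat) (M N : Type)
    (AM : atlas 'rV[R]_m M) (AN : atlas 'rV[R]_n N) (f : M -> N) (x : M) :
    'M[R]_(m, n) :=
  jacobian (coord (chart_at AN (f x)) \o f \o param (chart_at AM x))
           (coord (chart_at AM x) x).

(* d f(x) in T*_xM *)
Definition dcov (R : realType) (n : nat) (M : Type) (A : atlas 'rV[R]_n M)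
    (f : M -> R) (x : M) : 'cV[R]_n :=
  \col_i 'd (f \o param (chart_at A x) : 'rV[R]_n -> R^o)
            (coord (chart_at A x) x) (delta_mx 0 i).

Definition velocity (R : realType) (n : nat) (M : Type) (A : atlas 'rV[R]_n M)
    (c : R -> M) (t : R) : 'rV[R]_n :=
  derive1 (coord (chart_at A (c t)) \o c) t.

(* coordinate expression in the chart c of a vector field *)
Definition vf_coord (R : realType) (n : nat) (M : Type) (A : atlas 'rV[R]_n M)
    (c : chart A) (X : M -> 'rV[R]_n) (u : 'rV[R]_n) : 'rV[R]_n :=
  let x := param c u in X x *m chart_change (chart_at A x) c x.

Definition vf_bracket (R : realType) (n : nat) (M : Type)
    (A : atlas 'rV[R]_n M) (X Y : M -> 'rV[R]_n) (x : M) : 'rV[R]_n :=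
  let c := chart_at A x in let u := coord c x in
  let X' := vf_coord c X in let Y' := vf_coord c Y in
  'D_(X' u) Y' u - 'D_(Y' u) X' u.

Definition is_lie_group (R : realType) (n : nat) (G : groupType)
    (AG : atlas 'rV[R]_n G) : Prop :=
  [/\ is_manifold AG,
      smooth (prod_atlas AG AG) AG (fun p => (p.1 * p.2)%g) &
      smooth AG AG (fun g => (g^-1)%g)].

Definition Lmul (G : groupType) (g h : G) : G := (g * h)%g.

(* (h, v) |-> (g h, g v) on TG *)
Definition TL (R : realType) (n : nat) (G : groupType) (AG : atlas 'rV[R]_n G)
    (g : G) (p : G * 'rV[R]_n) : G * 'rV[R]_n :=
  ((g * p.1)%g, p.2 *m tmap AG AG (Lmul g) p.1).

(* cotangent lift of left translation: <g alpha, w> = <alpha, g^-1 w> *)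
Definition TstarL (R : realType) (n : nat) (G : groupType)
    (AG : atlas 'rV[R]_n G) (g : G) (p : G * 'cV[R]_n) : G * 'cV[R]_n :=
  ((g * p.1)%g, tmap AG AG (Lmul g^-1%g) (g * p.1)%g *m p.2).

(* g^-1 v := T_g L_{g^-1} v *)
Definition left_triv (R : realType) (n : nat) (G : groupType)
    (AG : atlas 'rV[R]_n G) (g : G) (v : 'rV[R]_n) : 'rV[R]_n :=
  v *m tmap AG AG (Lmul g^-1%g) g.

(* <g^-1 alpha, eta> = <alpha, T_e L_g eta> *)
Definition left_cotriv (R : realType) (n : nat) (G : groupType)
    (AG : atlas 'rV[R]_n G) (p : G * 'cV[R]_n) : 'cV[R]_n :=
  tmap AG AG (Lmul p.1) 1%g *m p.2.

Definition left_invariant_vf (R : realType) (n : nat) (G : groupType)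
    (AG : atlas 'rV[R]_n G) (xi : 'rV[R]_n) (g : G) : 'rV[R]_n :=
  xi *m tmap AG AG (Lmul g) 1%g.

Definition lie_bracket (R : realType) (n : nat) (G : groupType)
    (AG : atlas 'rV[R]_n G) (xi eta : 'rV[R]_n) : 'rV[R]_n :=
  vf_bracket AG (left_invariant_vf AG xi) (left_invariant_vf AG eta) 1%g.

(* ad^*_xi mu, as a linear functional on the Lie algebra *)
Definition ad_star (R : realType) (n : nat) (G : groupType)
    (AG : atlas 'rV[R]_n G) (xi : 'rV[R]_n) (mu : 'cV[R]_n)
    (eta : 'rV[R]_n) : R :=
  pairing mu (lie_bracket AG xi eta).

Definition one_parameter_subgroup (R : realType) (n : nat) (G : groupType)
    (AG : atlas 'rV[R]_n G) (xi : 'rV[R]_n) (gamma : R -> G) : Prop :=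
  [/\ smooth (line R) AG gamma,
      forall s t, gamma (s + t) = (gamma s * gamma t)%g &
      velocity AG gamma 0 = xi].

(* the default value 1 is never used on a Lie group *)
Definition lie_exp (R : realType) (n : nat) (G : groupType)
    (AG : atlas 'rV[R]_n G) (xi : 'rV[R]_n) : G :=
  xget 1%g [set g | exists2 gamma : R -> G,
                      one_parameter_subgroup AG xi gamma & g = gamma 1].

Definition is_smooth_action (R : realType) (n m : nat) (G : groupType)
    (AG : atlas 'rV[R]_n G) (M : Type) (AM : atlas 'rV[R]_m M)
    (act : G -> M -> M) : Prop :=
  [/\ forall x, act 1%g x = x,
      forall g h x, act (g * h)%g x = act g (act h x) &
      smooth (prod_atlas AG AM) AM (fun p => act p.1 p.2)].

Definition inf_generator (R : realType) (n m : nat) (G : groupType)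
    (AG : atlas 'rV[R]_n G) (M : Type) (AM : atlas 'rV[R]_m M)
    (act : G -> M -> M) (xi : 'rV[R]_n) (x : M) : 'rV[R]_m :=
  velocity AM (fun s => act (lie_exp AG (s *: xi)) x) 0.

Definition Orb (G : groupType) (M : Type) (act : G -> M -> M) (x0 : M) : Type :=
  {x : M | exists g, x = act g x0}.

Definition orbit_pt (G : groupType) (M : Type) (act : G -> M -> M) (x0 : M)
    (g : G) : Orb act x0 :=
  exist _ (act g x0) (ex_intro _ g erefl).

Definition orbit_incl (G : groupType) (M : Type) (act : G -> M -> M) (x0 : M)
    (a : Orb act x0) : M := sval a.

(* The manifold structure of the orbit, i.e. that of G / G_{x0}: it is the only
   one for which g |-> g x0 is a smooth submersion onto the orbit, and the
   inclusion into M is then an (injective) immersion. *)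
Definition is_orbit_manifold (R : realType) (n m k : nat) (G : groupType)
    (AG : atlas 'rV[R]_n G) (M : Type) (AM : atlas 'rV[R]_m M)
    (act : G -> M -> M) (x0 : M) (AO : atlas 'rV[R]_k (Orb act x0)) : Prop :=
  [/\ is_manifold AO,
      smooth AG AO (orbit_pt act x0),
      forall g, row_full (tmap AG AO (orbit_pt act x0) g),
      smooth AO AM (@orbit_incl G M act x0) &
      forall a, row_free (tmap AO AM (@orbit_incl G M act x0) a)].

(* a vector u of T_aM tangent to the orbit, seen in T_aOrb *)
Definition orbit_tangent (R : realType) (m k : nat) (G : groupType)
    (M : Type) (AM : atlas 'rV[R]_m M) (act : G -> M -> M) (x0 : M)
    (AO : atlas 'rV[R]_k (Orb act x0)) (a : Orb act x0) (u : 'rV[R]_m) :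
    'rV[R]_k :=
  xget 0 [set w | w *m tmap AO AM (@orbit_incl G M act x0) a = u].

(* <J(alpha), xi> = <alpha, xi_M(a)> for alpha in T*_aOrb *)
Definition momentum (R : realType) (n m k : nat) (G : groupType)
    (AG : atlas 'rV[R]_n G) (M : Type) (AM : atlas 'rV[R]_m M)
    (act : G -> M -> M) (x0 : M) (AO : atlas 'rV[R]_k (Orb act x0))
    (a : Orb act x0) (alpha : 'cV[R]_k) (xi : 'rV[R]_n) : R :=
  pairing alpha
    (orbit_tangent AM AO a (inf_generator AG AM act xi (orbit_incl a))).

Definition TGR_atlas (R : realType) (n : nat) (G : groupType)
    (AG : atlas 'rV[R]_n G) :=
  prod_atlas (tangent_atlas AG) (line R).

Definition reduced_atlas (R : realType) (n k : nat) (O : Type)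
    (AO : atlas 'rV[R]_k O) :=
  prod_atlas (prod_atlas (vect_atlas 'rV[R]_n) AO) (line R).

Definition is_invariant (R : realType) (n : nat) (G : groupType)
    (AG : atlas 'rV[R]_n G) (M : Type) (act : G -> M -> M) (x0 : M)
    (Phi : (G * 'rV[R]_n) * R -> R) : Prop :=
  forall g, act g x0 = x0 ->
  forall h v S, Phi (TL AG g (h, v), S) = Phi ((h, v), S).

Definition fiber_preserving (R : realType) (n : nat) (G : groupType)
    (Phi : (G * 'rV[R]_n) * R -> G * 'cV[R]_n) : Prop :=
  forall g v S, (Phi ((g, v), S)).1 = g.

Definition is_equivariant (R : realType) (n : nat) (G : groupType)
    (AG : atlas 'rV[R]_n G) (M : Type) (act : G -> M -> M) (x0 : M)
    (Phi : (G * 'rV[R]_n) * R -> G * 'cV[R]_n) : Prop :=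
  forall g, act g x0 = x0 ->
  forall h v S, Phi (TL AG g (h, v), S) = TstarL AG g (Phi ((h, v), S)).

Definition is_reduced_fun (R : realType) (n : nat) (G : groupType)
    (AG : atlas 'rV[R]_n G) (M : Type) (act : G -> M -> M) (x0 : M)
    (Phi : (G * 'rV[R]_n) * R -> R)
    (phi : ('rV[R]_n * Orb act x0) * R -> R) : Prop :=
  forall g v S,
    phi ((left_triv AG g v, orbit_pt act x0 g^-1%g), S) = Phi ((g, v), S).

Definition is_reduced_force (R : realType) (n : nat) (G : groupType)
    (AG : atlas 'rV[R]_n G) (M : Type) (act : G -> M -> M) (x0 : M)
    (Phi : (G * 'rV[R]_n) * R -> G * 'cV[R]_n)
    (phi : ('rV[R]_n * Orb act x0) * R -> 'cV[R]_n) : Prop :=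
  forall g v S,
    phi ((left_triv AG g v, orbit_pt act x0 g^-1%g), S) =
    left_cotriv AG (Phi ((g, v), S)).

Definition d_xi (R : realType) (n : nat) (O : Type)
    (l : ('rV[R]_n * O) * R -> R) (xi : 'rV[R]_n) (a : O) (S : R) : 'cV[R]_n :=
  dcov (vect_atlas 'rV[R]_n) (fun x => l ((x, a), S)) xi.

Definition d_a (R : realType) (n k : nat) (O : Type) (AO : atlas 'rV[R]_k O)
    (l : ('rV[R]_n * O) * R -> R) (xi : 'rV[R]_n) (a : O) (S : R) : 'cV[R]_k :=
  dcov AO (fun b => l ((xi, b), S)) a.

Definition d_S (R : realType) (n : nat) (O : Type)
    (l : ('rV[R]_n * O) * R -> R) (xi : 'rV[R]_n) (a : O) (S : R) : R :=
  derive1 (fun s => l ((xi, a), s) : R^o) S.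

Definition reduced_energy (R : realType) (n : nat) (O : Type)
    (l : ('rV[R]_n * O) * R -> R) (xi : 'rV[R]_n) (a : O) (S : R) : R :=
  pairing (d_xi l xi a S) xi - l ((xi, a), S).

Definition reduced_power (R : realType) (n : nat) (O : Type)
    (f : ('rV[R]_n * O) * R -> 'cV[R]_n) (xi : 'rV[R]_n) (a : O) (S : R) : R :=
  pairing (f ((xi, a), S)) xi.

(* Main.v *)
Require Import Defs.
From HB Require Import structures.
From mathcomp Require Import all_boot all_order all_algebra.
From mathcomp Require Import all_classical all_reals all_analysis.
From mathcomp Require Import ring.

Set Implicit Arguments.
Unset Strict Implicit.
Unset Printing Implicit Defensive.

Import Order.TTheory GRing.Theory Num.Theory.
Import numFieldNormedType.Exports.
(* Both the vector-space library and the charts use the name [coord]; the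
   charts are meant below. *)
Import Defs.

Local Open Scope classical_set_scope.
Local Open Scope ring_scope.

(** The energy balance is a chain-rule computation.  Near a time [t] the
    orbit variable stays in the preferred chart [c] of [a t], and there [l] is
    an ordinary smooth function of (xi, u, S) in a vector space (the function
    [local_rep]).  Its second derivatives exist, so the momentum
    [d_xi l (xi s) (a s) (S s)] is differentiable in [s]; the two terms
    <dl/dxi, xi'> coming from the product rule for <dl/dxi, xi> and from the
    chain rule for [l] cancel, which leaves
      de/dt = <(dl/dxi)', xi> - <dl/da, a'> - (dl/dS) S'
    ([is_derive_reduced_energy], valid along any smooth curve).

    The evolution equations enter only then.  Pairing the momentum equation
    with xi itself kills ad*, because [xi, xi] = 0 ([ad_star_self]).  The
    advection equation a' + xi_M(a) = 0 holds in the ambient manifold; since the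
    orbit is immersed, it says that the vector of the orbit representing xi_M(a)
    is -a', so <J(dl/da), xi> = - <dl/da, a'> ([momentum_along_curve]) and the
    dl/da terms cancel.  By the entropy equation (dl/dS) S' is the friction
    power minus the external heat power, so the friction powers cancel and the
    two external powers remain. *)

(** * Calculus along curves *)

Section Curves.
Variable R : realType.

Lemma is_derive_comp_curve (V W : normedModType R) (c : R -> V) (f : V -> W)
    (t : R) (dc : V) :
  is_derive (t : R^o) (1 : R^o) c dc -> differentiable f (c t) ->
  is_derive (t : R^o) (1 : R^o) (f \o c) ('d f (c t) dc).
Proof.
move=> [cd <-] fd.
have cd' : differentiable c t by apply/derivable1_diffP.
have fcd : differentiable (f \o c) t by exact: differentiable_comp.
apply: DeriveDef; first exact/derivable1_diffP.
rewrite (deriveE _ fcd) (deriveE _ cd').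
by rewrite (diff_comp cd' fd).
Qed.

Lemma is_derive_pairing (n : nat) (mu : R -> 'cV[R]_n) (v : R -> 'rV[R]_n)
    (t : R) (dmu : 'cV[R]_n) (dv : 'rV[R]_n) :
  is_derive (t : R^o) (1 : R^o) mu dmu -> is_derive (t : R^o) (1 : R^o) v dv ->
  is_derive (t : R^o) (1 : R^o) (fun s => pairing (mu s) (v s) : R^o)
    (pairing dmu (v t) + pairing (mu t) dv).
Proof.
move=> [mud <-] [vd <-].
have mui i : is_derive (t : R^o) (1 : R^o) (fun s => mu s i 0 : R^o)
    (('D_(1 : R^o) mu (t : R^o)) i 0).
  rewrite derive_mx// mxE; apply: derivableP.
  exact: ((derivable_mxP _ _ _).1 mud).
have vi i : is_derive (t : R^o) (1 : R^o) (fun s => v s 0 i : R^o)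
    (('D_(1 : R^o) v (t : R^o)) 0 i).
  rewrite derive_mx// mxE; apply: derivableP.
  exact: ((derivable_mxP _ _ _).1 vd).
rewrite (_ : (fun s => _) =
  \sum_(i < n) ((fun s => v s 0 i : R^o) * (fun s => mu s i 0 : R^o)));
  last by apply/funext => s; rewrite /pairing mxE fct_sumE.
apply: is_derive_eq.
rewrite big_split /pairing !mxE; congr (_ + _).
by apply: eq_bigr => i _; exact: mulrC.
Qed.

Lemma pairing_dcov (n : nat) (M : Type) (A : atlas 'rV[R]_n M) (f : M -> R)
    (x : M) (v : 'rV[R]_n) :
  pairing (dcov A f x) v =
  'd (f \o param (chart_at A x) : 'rV[R]_n -> R^o)
     (coord (chart_at A x) x) v.
Proof.
rewrite /pairing mxE [in RHS](row_sum_delta v) linear_sum.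
by apply: eq_bigr => i _; rewrite linearZ mxE.
Qed.

(** Being in the domain of a given chart is an open condition on the time, since
    smoothness of the curve includes openness of the set of such times.  So
    derivatives at [t] may be computed in the chart [d]. *)
Lemma curve_in_chart (V : normedModType R) (M : Type) (A : atlas V M)
    (I : set R) (c : R -> M) (t : R) (d : chart A) :
  smooth_on (line R) A I c -> I t -> dom d (c t) ->
  (\forall s \near t, dom d (c s)) /\
  differentiable (coord d \o c : R^o -> V) t.
Proof.
move=> [_ /(_ tt d) /= [oU Ck]] It dt.
pose U := [set id x | x in I `&` setT `&` c @^-1` dom d].
have Ut : U t by exists t.
split; last exact: (Ck 1%N).1.
have : nbhs t U by exact: open_nbhs_nbhs.
by apply: filterS => s [x [_ ?] <-].
Qed.

(** The chain rule.  The curve factors through the chart at [c t] only for times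
    near [t], which is enough for a derivative at [t]. *)
Lemma velocity_comp (m n : nat) (M N : Type) (AM : atlas 'rV[R]_m M)
    (AN : atlas 'rV[R]_n N) (hM : is_manifold AM) (hN : is_manifold AN)
    (f : M -> N) (I : set R) (c : R -> M) (t : R) :
  smooth AM AN f -> smooth_on (line R) AM I c -> I t ->
  velocity AN (f \o c) t = velocity AM c t *m tmap AM AN f (c t).
Proof.
move=> [_ fC] cC It; have [domM paramM _ _ _] := hM; have [domN _ _ _ _] := hN.
have [near_dom cd] := curve_in_chart cC It (domM _).
set d := chart_at AM (c t) in near_dom cd *.
set e := chart_at AN (f (c t)).
have [_ /(_ 1%N)[fd _]] := fC d e.
rewrite /velocity !derive1E -/d -/e.
rewrite -(@near_eq_derive _ R^o _
  ((coord e \o f \o param d) \o (coord d \o c))); last first.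
  by apply: filterS near_dom => s ds /=; rewrite paramM.
have fd' : differentiable (coord e \o f \o param d) ((coord d \o c) t).
  by apply: fd; exists (c t) => //; split; [split|] => //;
    [exact: domM|exact: domN].
rewrite (deriveE _ (differentiable_comp cd fd')) (diff_comp cd fd') /=.
by rewrite -(deriveE _ cd) -(deriveE _ fd') (deriveEjacobian _ fd').
Qed.

End Curves.

(** * The terms of the momentum equation, paired with xi *)

Lemma ad_star_self (R : realType) (n : nat) (G : groupType)
    (AG : atlas 'rV[R]_n G) (xi : 'rV[R]_n) (mu : 'cV[R]_n) :
  ad_star AG xi mu xi = 0.
Proof.
by rewrite /ad_star /lie_bracket /vf_bracket subrr /pairing mul0mx mxE.
Qed.

(** The tangent map of the immersion is injective, so the chosen preimage of a
    vector tangent to the orbit is the only one. *)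
Lemma orbit_tangentE (R : realType) (m k : nat) (G : groupType)
    (M : Type) (AM : atlas 'rV[R]_m M) (act : G -> M -> M) (x0 : M)
    (AO : atlas 'rV[R]_k (Orb act x0)) (a : Orb act x0) (w : 'rV[R]_k) :
  row_free (tmap AO AM (@orbit_incl G M act x0) a) ->
  orbit_tangent AM AO a (w *m tmap AO AM (@orbit_incl G M act x0) a) = w.
Proof.
move=> free; rewrite /orbit_tangent; case: xgetP => [w' _ /=|].
  exact: row_free_inj.
by move=> /(_ w) /=.
Qed.

(** The inclusion of the orbit maps the velocity of [a] to its velocity in the
    ambient manifold, which is -xi_M(a) by the advection equation. *)
Lemma momentum_along_curve (R : realType) (n m k : nat) (G : groupType)
    (AG : atlas 'rV[R]_n G) (M : Type) (AM : atlas 'rV[R]_m M)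
    (act : G -> M -> M) (x0 : M) (AO : atlas 'rV[R]_k (Orb act x0))
    (hM : is_manifold AM) (hO : is_orbit_manifold AG AM AO)
    (I : set R) (a : R -> Orb act x0) (t : R) (xi : 'rV[R]_n)
    (alpha : 'cV[R]_k) :
  smooth_on (line R) AO I a -> I t ->
  velocity AM (fun s => orbit_incl (a s)) t
    + inf_generator AG AM act xi (orbit_incl (a t)) = 0 ->
  momentum AG AM AO (a t) alpha xi = - pairing alpha (velocity AO a t).
Proof.
case: hO => hAO _ _ incl free aI It.
rewrite -[fun s => _]/(@orbit_incl G M act x0 \o a).
rewrite (velocity_comp hAO hM incl aI It) => /eqP.
rewrite addrC addr_eq0 => /eqP E.
rewrite /momentum E -mulNmx orbit_tangentE; last exact: free.
by rewrite /pairing mulNmx mxE.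
Qed.

(** * The reduced Lagrangian in a chart of the orbit *)

Section LocalLagrangian.
Variables (R : realType) (n k : nat) (O : Type) (AO : atlas 'rV[R]_k O).
Hypothesis hO : is_manifold AO.
Variable l : ('rV[R]_n * O) * R -> R.
Hypothesis hl : smooth (reduced_atlas n AO) (line R) l.

Definition local_rep (c : chart AO) (z : ('rV[R]_n * 'rV[R]_k) * R^o) : R^o :=
  l ((z.1.1, param c z.1.2), z.2).

(** Smoothness of [l], read in the chart given by [c] on the orbit factor and by
    the identity on the two vector-space factors.  Iterated differentiability
    is only stated on a set, hence the domain [U]. *)
Lemma local_rep_Ck (c : chart AO) (j : nat) :
  exists U : set (('rV[R]_n * 'rV[R]_k) * R^o),
  (forall xi a S, dom c a -> U ((xi, coord c a), S)) /\ Ck j U (local_rep c).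
Proof.
have [_ /(_ ((tt, c), tt) tt)[_ /(_ j)] h] := hl.
by eexists; split; last exact: h; move=> xi a S da; exists ((xi, a), S).
Qed.

Lemma differentiable_local_rep (c : chart AO) xi a (S : R) : dom c a ->
  differentiable (local_rep c) ((xi, coord c a), S).
Proof. by move=> da; have [U [UP [h _]]] := local_rep_Ck c 1; apply/h/UP. Qed.

Lemma differentiable_derive_local_rep (c : chart AO) v xi a (S : R) : dom c a ->
  differentiable (fun z => 'D_v (local_rep c) z) ((xi, coord c a), S).
Proof.
by move=> da; have [U [UP [_ /(_ v)[h _]]]] := local_rep_Ck c 2; apply/h/UP.
Qed.

(** The chart [c] is arbitrary here, unlike in [pairing_d_a]: along a curve
    [a s], the covector [d_xi] has to be expressed for all [s] near [t] in the
    one chart around [a t]. *)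
Lemma pairing_d_xi (c : chart AO) xi a (S : R) v : dom c a ->
  pairing (d_xi l xi a S) v = 'd (local_rep c) ((xi, coord c a), S) ((v, 0), 0).
Proof.
move=> da; rewrite pairing_dcov/=; have [_ pK _ _ _] := hO.
have := differentiable_local_rep xi S da.
set z := (_, S) => dz.
have di : is_diff xi (fun x : 'rV[R]_n => ((x, coord c a), S : R^o))
   (fun v : 'rV[R]_n => ((v, 0), 0)).
  exact: (is_diff_pair (is_diff_pair (is_diff_id xi) (is_diff_cst _ xi))
                       (is_diff_cst (S : R^o) xi)).
rewrite (_ : _ \o id =
  local_rep c \o (fun x : 'rV[R]_n => ((x, coord c a), S : R^o))).
  by rewrite diff_comp//= diff_val.
by apply/funext => x; rewrite /local_rep/= pK.
Qed.

Lemma pairing_d_a xi a (S : R) w :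
  pairing (d_a AO l xi a S) w =
  'd (local_rep (chart_at AO a)) ((xi, coord (chart_at AO a) a), S) ((0, w), 0).
Proof.
rewrite pairing_dcov; have [da _ _ _ _] := hO.
set c := chart_at AO a.
have := differentiable_local_rep xi S (da a); rewrite -/c.
set z := (_, S) => dz.
have di : is_diff (coord c a) (fun u : 'rV[R]_k => ((xi, u), S : R^o))
   (fun w : 'rV[R]_k => ((0, w), 0)).
  exact: (is_diff_pair (is_diff_pair (is_diff_cst xi _) (is_diff_id _))
                       (is_diff_cst (S : R^o) _)).
rewrite (_ : _ \o _ =
  local_rep c \o (fun u : 'rV[R]_k => ((xi, u), S : R^o)))//.
by rewrite diff_comp//= diff_val.
Qed.

Lemma d_S_mulr (c : chart AO) xi a (S r : R) : dom c a ->
  d_S l xi a S * r = 'd (local_rep c) ((xi, coord c a), S) ((0, 0), r).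
Proof.
move=> da; rewrite /d_S; have [_ pK _ _ _] := hO.
have dz := differentiable_local_rep xi S da.
have di : is_diff (S : R^o) (fun s : R^o => ((xi, coord c a), s))
   (fun r : R^o => ((0, 0), r)).
  exact: (is_diff_pair (is_diff_cst (xi, coord c a) _) (is_diff_id _)).
rewrite (_ : (fun s => _) =
  local_rep c \o (fun s : R^o => ((xi, coord c a), s))).
  have [ds _] := di; have dc := differentiable_comp ds dz.
  rewrite mulrC -[_ * _]/(_ *: _).
  have /(congr1 (@^~ r)) /= <- := diff1E dc.
  by rewrite diff_comp//= diff_val.
by apply/funext => x; rewrite /local_rep/= pK.
Qed.

Lemma diff_local_rep xi a (S : R) x w (r : R) :
  'd (local_rep (chart_at AO a)) ((xi, coord (chart_at AO a) a), S) ((x, w), r)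
  = pairing (d_xi l xi a S) x + pairing (d_a AO l xi a S) w + d_S l xi a S * r.
Proof.
have [da _ _ _ _] := hO.
rewrite (pairing_d_xi _ _ _ (da a)) pairing_d_a (d_S_mulr _ _ _ (da a)).
rewrite -!linearD.
have -> // : ((x, w), r : R^o) = ((x, 0), 0) + ((0, w), 0) + ((0, 0), r).
by congr (_, _, _); rewrite /= ?addr0 ?add0r.
Qed.

(** * The derivative of the energy along a curve *)

Variables (I : set R) (xi : R -> 'rV[R]_n) (a : R -> O) (S : R -> R) (t : R).
Hypotheses (It : I t) (hxi : smooth_on (line R) (vect_atlas 'rV[R]_n) I xi).
Hypotheses (ha : smooth_on (line R) AO I a).
Hypothesis (hS : smooth_on (line R) (line R) I S).

Let c := chart_at AO (a t).
Let z (s : R) : ('rV[R]_n * 'rV[R]_k) * R^o := ((xi s, coord c (a s)), S s).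

Let near_c : \forall s \near t, dom c (a s).
Proof.
by have [da _ _ _ _] := hO; have [] := curve_in_chart ha It (da (a t)).
Qed.

Let dxi : differentiable (xi : R^o -> _) t.
Proof.
have [] // :=
  curve_in_chart (A := vect_atlas 'rV[R]_n) (d := tt) hxi It Logic.I.
Qed.

Let is_derive_z : is_derive (t : R^o) (1 : R^o) z
  ((derive1 xi t, velocity AO a t), derive1 (S : R -> R^o) t).
Proof.
have [da _ _ _ _] := hO; have [_ dca] := curve_in_chart ha It (da (a t)).
have [_ dS] := curve_in_chart (A := line R) (d := tt) hS It Logic.I.
have dz := differentiable_pair (differentiable_pair dxi dca) dS.
apply: DeriveDef; first exact/derivable1_diffP.
rewrite (deriveE _ dz) (diff_pair (differentiable_pair dxi dca) dS).
rewrite (diff_pair dxi dca) /velocity !derive1E.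
by rewrite (deriveE _ dxi) (deriveE _ dca) (deriveE _ dS).
Qed.

(** By [pairing_d_xi] the entries of the momentum are directional derivatives of
    [local_rep c], which are themselves differentiable, evaluated along the
    curve read in the chart [c]. *)
Lemma is_derive_d_xi :
  is_derive (t : R^o) (1 : R^o) (fun s => d_xi l (xi s) (a s) (S s))
    (derive1 (fun s => d_xi l (xi s) (a s) (S s)) t).
Proof.
rewrite derive1E; apply: derivableP; apply/derivable_mxP => i j.
rewrite (ord1 j).
pose v : ('rV[R]_n * 'rV[R]_k) * R^o := ((delta_mx 0 i, 0), 0).
apply: (@near_eq_derivable _ R^o _ ((fun u => 'D_v (local_rep c) u) \o z)).
  apply: filterS near_c => s ds /=.
  rewrite deriveE; last exact: differentiable_local_rep.
  rewrite -(pairing_d_xi _ _ _ ds).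
  by rewrite /pairing -rowE mxE.
have [dz _] := is_derive_z; apply/derivable1_diffP.
apply: differentiable_comp; first exact/derivable1_diffP.
by apply: differentiable_derive_local_rep; exact: nbhs_singleton near_c.
Qed.

(** The <dl/dxi, xi'> from the product rule cancels the one from the chain
    rule. *)
Lemma is_derive_reduced_energy :
  is_derive (t : R^o) (1 : R^o)
    (fun s => reduced_energy l (xi s) (a s) (S s) : R^o)
    (pairing (derive1 (fun s => d_xi l (xi s) (a s) (S s)) t) (xi t)
     - pairing (d_a AO l (xi t) (a t) (S t)) (velocity AO a t)
     - d_S l (xi t) (a t) (S t) * derive1 (S : R -> R^o) t).
Proof.
have dxi' : is_derive (t : R^o) (1 : R^o) xi (derive1 xi t).
  by rewrite derive1E; apply/derivableP/derivable1_diffP.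
have dc : dom c (a t) by exact: nbhs_singleton near_c.
have dl := is_derive_comp_curve is_derive_z (differentiable_local_rep _ _ dc).
(* [local_rep c] read along [z] is [l] along the curve as long as [a] stays in
   the chart [c] *)
have dlz : is_derive (t : R^o) (1 : R^o)
    (fun s => l ((xi s, a s), S s) : R^o)
    ('d (local_rep c) (z t)
       ((derive1 xi t, velocity AO a t), derive1 (S : R -> R^o) t)).
  apply: (@near_eq_is_derive _ R^o R^o _ _ _ _ _ _ dl); have [_ pK _ _ _] := hO.
  by apply: filterS near_c => s ds; rewrite /local_rep/= pK.
apply: (is_derive_eq
  (is_deriveB (is_derive_pairing is_derive_d_xi dxi') dlz)).
rewrite diff_local_rep.
by rewrite !opprD !addrA addrK.
Qed.

End LocalLagrangian.

(** * The energy balance *)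

Theorem corollary1p5 (R : realType) (n m k : nat)
  (* the Lie group G, the manifold M, the action, and Orb(aref) *)
  (G : groupType) (AG : atlas 'rV[R]_n G) (hG : is_lie_group AG)
  (M : Type) (AM : atlas 'rV[R]_m M) (hM : is_manifold AM)
  (act : G -> M -> M) (hact : is_smooth_action AG AM act)
  (aref : M)
  (AO : atlas 'rV[R]_k (Orb act aref)) (hO : is_orbit_manifold AG AM AO)
  (* Lagrangian, forces and heat power on TG x R *)
  (L : (G * 'rV[R]_n) * R -> R)
  (hLs : smooth (TGR_atlas AG) (line R) L)
  (hLi : is_invariant AG act aref L)
  (Fext Ffr : (G * 'rV[R]_n) * R -> G * 'cV[R]_n)
  (hFexts : smooth (TGR_atlas AG) (cotangent_atlas AG) Fext)
  (hFextp : fiber_preserving Fext)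
  (hFexte : is_equivariant AG act aref Fext)
  (hFfrs : smooth (TGR_atlas AG) (cotangent_atlas AG) Ffr)
  (hFfrp : fiber_preserving Ffr)
  (hFfre : is_equivariant AG act aref Ffr)
  (PH : (G * 'rV[R]_n) * R -> R)
  (hPHs : smooth (TGR_atlas AG) (line R) PH)
  (hPHi : is_invariant AG act aref PH)
  (* their reduced maps on g x Orb(aref) x R *)
  (l : ('rV[R]_n * Orb act aref) * R -> R)
  (hls : smooth (reduced_atlas n AO) (line R) l)
  (hl : is_reduced_fun AG L l)
  (fext ffr : ('rV[R]_n * Orb act aref) * R -> 'cV[R]_n)
  (hfexts : smooth (reduced_atlas n AO) (vect_atlas 'cV[R]_n) fext)
  (hfext : is_reduced_force AG Fext fext)
  (hffrs : smooth (reduced_atlas n AO) (vect_atlas 'cV[R]_n) ffr)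
  (hffr : is_reduced_force AG Ffr ffr)
  (pH : ('rV[R]_n * Orb act aref) * R -> R)
  (hpHs : smooth (reduced_atlas n AO) (line R) pH)
  (hpH : is_reduced_fun AG PH pH)
  (* the curve (g, xi, a, S), on an open time interval I *)
  (I : set R) (hIo : open I) (hIi : is_interval I)
  (g : R -> G) (xi : R -> 'rV[R]_n) (a : R -> Orb act aref) (S : R -> R)
  (hgs : smooth_on (line R) AG I g)
  (hxis : smooth_on (line R) (vect_atlas 'rV[R]_n) I xi)
  (hasm : smooth_on (line R) AO I a)
  (hSs : smooth_on (line R) (line R) I S)
  (hxi : forall t, I t -> xi t = left_triv AG (g t) (velocity AG g t))
  (ha : forall t, I t -> a t = orbit_pt act aref (g t)^-1%g)
  (* the evolution equations; the first one is an equality of linear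
     functionals on the Lie algebra *)
  (heq1 : forall t, I t -> forall eta : 'rV[R]_n,
     pairing (derive1 (fun s => d_xi l (xi s) (a s) (S s)) t) eta =
       ad_star AG (xi t) (d_xi l (xi t) (a t) (S t)) eta
       - momentum AG AM AO (a t) (d_a AO l (xi t) (a t) (S t)) eta
       + pairing (fext ((xi t, a t), S t)) eta
       + pairing (ffr ((xi t, a t), S t)) eta)
  (heq2 : forall t, I t ->
     d_S l (xi t) (a t) (S t) * derive1 (S : R -> R^o) t =
       pairing (ffr ((xi t, a t), S t)) (xi t) - pH ((xi t, a t), S t))
  (heq3 : forall t, I t ->
     velocity AM (fun s => orbit_incl (a s)) t
       + inf_generator AG AM act (xi t) (orbit_incl (a t)) = 0) :
  forall t, I t ->
    is_derive (t : R^o) (1 : R^o)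
      (fun s => reduced_energy l (xi s) (a s) (S s) : R^o)
      (reduced_power fext (xi t) (a t) (S t) + pH ((xi t, a t), S t)).
Proof.
move=> t It; have [hAO _ _ _ _] := hO.
apply: is_derive_eq (is_derive_reduced_energy hAO hls It hxis hasm hSs) _.
rewrite heq1// heq2// ad_star_self.
rewrite (momentum_along_curve hM hO _ hasm It (heq3 t It)) /reduced_power.
ring.
Qed.
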